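(* Let $n\ge 3$ and let $p(z)=\prod_{i=1}^n(z-z_i)\in S_n$ be such that both $p$ and $p'$ have only simple zeros. Suppose that the $z_i$ are labeled so that $|p|_{z_i}=d(p)$ for $1\le i\le t$ and $|p|_{z_i}<d(p)$ for $i\ge t+1$, where $t\in\{1,\dots,n\}$. Then $p$ is linearly inextensible if and only if all the matrices $A(p;z_i)$, $1\le i\le t$, are positively singular.
   Context: $S_n$ is the set of monic complex polynomials of degree $n$ with all zeros in the closed unit disk, and $Z(p)$ denotes the zero set of $p$. For $\alpha\in\mathbb{C}$, $|p|_\alpha=\min_{w\in Z(p')}|\alpha-w|$, and $d(p)=\max_{z\in Z(p)}|p|_z$. For monic $p(z)=\prod_{i=1}^n(z-z_i)$ and $q(z)=\prod_{i=1}^n(z-\zeta_i)$, $\Delta(p,q)=\min_{\sigma\in\Sigma_n}\max_{1\le i\le n}|z_i-\zeta_{\sigma(i)}|$, where $\Sigma_n$ is the symmetric group. A polynomial $p\in S_n$ is linearly inextensible if there exist $\varepsilon>0$ and constants $C\ge 0$, $\kappa>0$ depending only on $p$ such that $d(q)\le d(p)+C\,\Delta(q,p)^{1+\kappa}$ for all $q\in S_n$ with $\Delta(q,p)<\varepsilon$. A complex $m\times n$ matrix $(m_{ij})$ is positively singular if there exist real $\mu_1,\dots,\mu_m\ge 0$, not all $0$, such that $\sum_{i=1}^m\mu_i m_{ij}=0$ for $1\le j\le n$. Definition of $A(p;a)$ for a zero $a=z_l$ of $p$ with $|p|_a=d(p)$: let $p'(z)=n\prod_{j=1}^{n-1}(z-w_j)$,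 with the $w_j$ labeled (depending on $a$) so that $|w_j-a|=|p|_a$ for $1\le j\le r$ and $|w_j-a|>|p|_a$ for $j\ge r+1$, where $r=r(a)\in\{1,\dots,n-1\}$. Let $1\le s_1<\dots<s_m\le n$ be the indices $i$ for which $|z_i|=1$. For $1\le j\le r$ put $$\alpha_l(w_j;a)=-\frac{1}{w_j-a}\left[1+\frac{p(w_j)}{(w_j-a)^2p''(w_j)}\right],\qquad \alpha_i(w_j;a)=-\frac{p(w_j)}{(w_j-a)(w_j-z_i)^2p''(w_j)},\quad 1\le i\le n,\ i\ne l.$$ Then $A(p;a)=(a_{ij})$ is the $(r+m)\times n$ matrix with $a_{ij}=\alpha_j(w_i;a)$ for $1\le i\le r$, $1\le j\le n$; $a_{ij}=-\overline{z}_{s_k}$ if $i=r+k$ and $j=s_k$ for $1\le k\le m$; and $a_{ij}=0$ otherwise. (Reordering rows or columns does not affect positive singularity.) *)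

(* Defs.v *)
From HB Require Import structures.
From mathcomp Require Import all_boot all_order all_algebra all_fingroup.
From mathcomp Require Import complex.
From mathcomp Require Import reals exp.
Set Implicit Arguments.
Unset Strict Implicit.
Unset Printing Implicit Defensive.
Import Order.TTheory GRing.Theory Num.Theory.
Local Open Scope ring_scope.

(* The modulus, as an element of R: on R[i] the library norm `|x| is valued in
   R[i], and equals (cabs x)%:C. *)
Definition cabs (R : realType) (x : R[i]) : R := Normc.normc x.

Lemma cabsE (R : realType) (x : R[i]) : `|x| = (cabs x)%:C%C.
Proof. by []. Qed.

(* The zeros of p listed with multiplicity, in an unspecified order. *)
Definition zeros (R : realType) (p : {poly R[i]}) : seq R[i] :=
  sval (closed_field_poly_normal p).

Lemma zerosE (R : realType) (p : {poly R[i]}) :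
  p = lead_coef p *: \prod_(z <- zeros p) ('X - z%:P).
Proof. exact: (svalP (closed_field_poly_normal p)). Qed.

Lemma mem_zeros (R : realType) (p : {poly R[i]}) (x : R[i]) :
  p != 0 -> (x \in zeros p) = root p x.
Proof.
by move=> p0; rewrite [p in root p]zerosE rootZ ?lead_coef_eq0 // root_prod_XsubC.
Qed.

Definition in_S (R : realType) (n : nat) (p : {poly R[i]}) : Prop :=
  [/\ p \is monic, size p = n.+1 & forall x, root p x -> cabs x <= 1].

Definition simple_zeros (R : realType) (p : {poly R[i]}) : Prop :=
  forall x, root p x -> mup x p = 1%N.

(* |p|_alpha, the distance from alpha to the critical points of p.  The initial
   value of the minimum is itself one of the values minimized over as soon as
   p' has a zero. *)
Definition crit_dist (R : realType) (p : {poly R[i]}) (alpha : R[i]) : R :=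
  \big[Num.min/cabs (alpha - (zeros p^`())`_0)]_(w <- zeros p^`())
    cabs (alpha - w).

(* The maximized values are nonnegative, so the initial value 0 is harmless;
   likewise in Delta. *)
Definition dmax (R : realType) (p : {poly R[i]}) : R :=
  \big[Num.max/0]_(z <- zeros p) crit_dist p z.

(* Minimizing over all permutations makes this independent of the order in
   which the n zeros of p and of q are listed; the initial value of the minimum
   is the value at the identity. *)
Definition Delta (R : realType) (n : nat) (p q : {poly R[i]}) : R :=
  let dist (s : 'S_n) : R :=
    \big[Num.max/0]_(i < n) cabs ((zeros p)`_i - (zeros q)`_(s i)) in
  \big[Num.min/dist 1%g]_(s : 'S_n) dist s.

Definition linearly_inextensible (R : realType) (n : nat) (p : {poly R[i]}) :
    Prop :=
  exists eps C kappa : R, [/\ 0 < eps, 0 <= C, 0 < kappa &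
    forall q : {poly R[i]}, in_S n q -> Delta n q p < eps ->
      dmax q <= dmax p + C * powR (Delta n q p) (1 + kappa)].

Definition positively_singular (R : realType) (m n : nat) (M : 'M[R[i]]_(m, n)) :
    Prop :=
  exists mu : 'I_m -> R, [/\ forall i, 0 <= mu i, exists i, mu i != 0 &
    forall j, \sum_(i < m) (mu i)%:C%C * M i j = 0].

(* The critical points w_1, ..., w_r of p closest to a; r is the size. *)
Definition near_crit (R : realType) (p : {poly R[i]}) (a : R[i]) : seq R[i] :=
  [seq w <- zeros p^`() | cabs (w - a) == crit_dist p a].

(* The indices s_1 < ... < s_m are the successive values of enum_val on it. *)
Definition unit_idx (R : realType) (n : nat) (z : 'I_n -> R[i]) : {set 'I_n} :=
  [set i | cabs (z i) == 1].

(* alpha_i(w; z_l) *)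
Definition alpha_coef (R : realType) (n : nat) (p : {poly R[i]})
    (z : 'I_n -> R[i]) (l : 'I_n) (w : R[i]) (i : 'I_n) : R[i] :=
  let a := z l in
  if i == l then
    - (w - a)^-1 * (1 + p.[w] / ((w - a) ^+ 2 * p^`(2).[w]))
  else
    - (p.[w] / ((w - a) * (w - z i) ^+ 2 * p^`(2).[w])).

(* A(p; z_l), where z lists the zeros of p. *)
Definition Amx (R : realType) (n : nat) (p : {poly R[i]}) (z : 'I_n -> R[i])
    (l : 'I_n) : 'M[R[i]]_(size (near_crit p (z l)) + #|unit_idx z|, n) :=
  col_mx
    (\matrix_(i, j) alpha_coef p z l (near_crit p (z l))`_i j)
    (\matrix_(k, j) if j == enum_val k then - (z j)^*%C else 0).

(* Main.v *)
Require Import Defs.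
From mathcomp Require Import all_boot all_order all_algebra all_fingroup.
From mathcomp Require Import complex.
From mathcomp Require Import reals exp.
From mathcomp Require Import ring lra.
From mathcomp Require boolp.

(* Move each zero z_i of p to z_i + h_i with |h_i| <= d.  To first order a simple
   critical point w moves by the increment determined by sum_i 1/(w - z_i) = 0,
   so |w - z_l|^2 is multiplied by 1 + 2 Re(sum_i alpha_i(w; z_l) h_i) + O(d^2),
   and the zeros on the unit circle stay in the disk, to first order, iff
   Re(-conj(z_s) h_s) >= 0.  By Gordan's alternative, A(p; z_l) is either
   positively singular or has a direction h with all these real parts positive.
   In the second case moving along h increases |p|_{z_l} at a linear rate, so p
   is not linearly inextensible.  In the first case, averaging the expansions
   over the weights mu bounds |q|_{z_l + h_l} by |p|_{z_l} + O(d^2), so p is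
   linearly inextensible with kappa = 1.

   The expansion of w needs no implicit function theorem: at the first-order
   prediction u one has q'(u) = O(d^2) q(u) while q''(u)/q(u) stays away from 0,
   and q''/q'(u) = sum_k 1/(u - v_k) over the zeros v_k of q' forces some v_k to
   be within O(d^2) of u. *)

Set Implicit Arguments.
Unset Strict Implicit.
Unset Printing Implicit Defensive.
Import Order.TTheory GRing.Theory Num.Theory.
Local Open Scope ring_scope.
Local Notation Re := complex.Re.
Local Notation Im := complex.Im.

(** * Gordan's alternative *)

Section Gordan.
Variables (F : realFieldType) (T : finType).
Implicit Types u v : T -> F.

Let dot u v := \sum_t u t * v t.

Lemma dotDr u v w a : dot u (fun t => v t + a * w t) = dot u v + a * dot u w.
Proof.
rewrite /dot mulr_sumr -big_split; apply: eq_bigr => t _ /=; ring.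
Qed.

Lemma dotDl u v w a : dot (fun t => v t + a * w t) u = dot v u + a * dot w u.
Proof.
rewrite /dot mulr_sumr -big_split; apply: eq_bigr => t _ /=; ring.
Qed.

Lemma dot_gt0 v : ~~ [forall t, v t == 0] -> 0 < dot v v.
Proof.
case/forallPn=> t vt; rewrite /dot (bigD1 t) //=.
by rewrite ltr_wpDr ?sumr_ge0 // => [s _|]; rewrite -expr2 ?sqr_ge0 // exprn_even_gt0.
Qed.

(** Finitely many strict inequalities survive a small perturbation: [e] is the inverse of a number
    exceeding every |b_i| / a_i. *)
Lemma small_shift m (a b : 'I_m -> F) :
  (forall i, 0 < a i) -> exists2 e, 0 < e & forall i, 0 < a i + e * b i.
Proof.
move=> a0; pose B := 1 + \sum_i `|b i| / a i.
have B0 : 0 < B.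
  by rewrite ltr_wpDr ?sumr_ge0 // => i _; rewrite divr_ge0 // ltW.
exists B^-1 => [|i]; first by rewrite invr_gt0.
have : `|b i| / a i < B.
  rewrite /B (bigD1 i) //= addrCA ltrDl ltr_wpDr // sumr_ge0 // => j _.
  by rewrite divr_ge0 // ltW.
rewrite ltr_pdivrMr // -ltr_pdivrMl // => Bb.
have : - (B^-1 * `|b i|) <= B^-1 * b i.
  by rewrite -mulrN ler_pM2l ?invr_gt0 // lerNl -normrN ler_norm.
by lra.
Qed.

(* Gordan's alternative, by induction on the number of vectors: if h solves the
   system without v0 but not with it, project the other vectors along v0. *)
Lemma gordan m (v : 'I_m -> T -> F) :
  (exists mu : 'I_m -> F, [/\ forall i, 0 <= mu i, exists i, mu i != 0 &
     forall t, \sum_i mu i * v i t = 0]) \/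
  (exists h, forall i, 0 < \sum_t v i t * h t).
Proof.
elim: m v => [|m IH] v; first by right; exists (fun=> 0) => -[].
pose v0 := v ord0; pose v' i := v (lift ord0 i).
case: (IH v') => [[mu [mu0 [i mui] muv]]|[h hP]].
  left; exists (fun j => oapp mu 0 (unlift ord0 j)); split=> [j||t].
  - by case: unliftP => [j' _|_] //=.
  - by exists (lift ord0 i); rewrite liftK.
  - rewrite big_ord_recl unlift_none mul0r add0r -[RHS](muv t).
    by apply: eq_bigr => j _; rewrite liftK.
have split_ord x : 0 < dot v0 x -> (forall i, 0 < dot (v' i) x) ->
    exists h, forall i, 0 < \sum_t v i t * h t.
  move=> x0 x'; exists x => j; case: (unliftP ord0 j) => [i ->|->].
    exact: x'.
  exact: x0.
have [dv0|dv0] := ltrP 0 (dot v0 h); first by right; apply: (split_ord h).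
have [/forallP vz|vnz] := boolP [forall t, v0 t == 0].
  left; exists (fun j => (j == ord0)%:R); split=> [j||t].
  - exact: ler0n.
  - by exists ord0; rewrite eqxx oner_neq0.
  - rewrite big_ord_recl [v ord0 t](eqP (vz t)) mulr0 add0r big1 // => j _.
    by rewrite mul0r.
have vv0 := dot_gt0 vnz.
have [d0|d0] := eqVneq (dot v0 h) 0.
  have [e e0 eP] := small_shift (fun i => dot (v' i) v0) hP.
  right; apply: (split_ord (fun t => h t + e * v0 t)) => [|i].
    by rewrite dotDr d0 add0r mulr_gt0.
  by rewrite dotDr; exact: eP.
have dlt : dot v0 h < 0 by rewrite lt_neqAle d0.
(* These nonnegative coefficients make every v'_i + c_i v_0 orthogonal to h. A positive dependence
   among the new vectors unfolds to one among the v'_i and v_0. *)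
pose c i := - dot (v' i) h / dot v0 h.
have c0 i : 0 <= c i.
  by rewrite /c mulNr -mulrN -invrN divr_ge0 ?oppr_ge0 // ltW // hP.
case: (IH (fun i t => v' i t + c i * v0 t)) => [[mu [mu0 [i mui] muv]]|[x xP]].
  left; exists (fun j => oapp mu (\sum_i mu i * c i) (unlift ord0 j)).
  split=> [j||t].
  - by case: unliftP => [j' _|_] //=; rewrite sumr_ge0 // => k _; rewrite mulr_ge0.
  - by exists (lift ord0 i); rewrite liftK.
  - rewrite big_ord_recl unlift_none /= mulr_suml addrC -big_split /=.
    rewrite -[RHS](muv t); apply: eq_bigr => j _.
    by rewrite liftK /= mulrDr [_ * (c j * _)]mulrA.
(* Moving x along h until it is orthogonal to v_0 keeps its products with the v'_i + c_i v_0. A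
   further small step along -h then makes the product with v_0 positive. *)
pose y t := x t + (- (dot v0 x / dot v0 h)) * h t.
have y0 : dot v0 y = 0 by rewrite dotDr mulNr divfK // subrr.
have yP i : 0 < dot (v' i) y.
  have E : c i * dot v0 x = - (dot v0 x / dot v0 h) * dot (v' i) h.
    by rewrite /c !mulNr mulrAC [in RHS]mulrAC [_ * dot v0 x]mulrC.
  by rewrite dotDr -E -dotDl; exact: xP.
have [e e0 eP] := small_shift (fun i => - dot (v' i) h) yP.
right; apply: (split_ord (fun t => y t + (- e) * h t)) => [|i].
  by rewrite dotDr y0 add0r mulNr oppr_gt0 pmulr_rlt0.
by rewrite dotDr mulNr -mulrN; exact: eP.
Qed.

End Gordan.

(** * Modulus and logarithmic derivatives *)

Section Modulus.
Variable R : realType.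
Implicit Types x y : R[i].

Lemma cabs_ge0 x : 0 <= cabs x.
Proof. by case: x => a b; exact: sqrtr_ge0. Qed.

Lemma cabs0 : cabs 0 = 0 :> R.
Proof. exact: Normc.normc0. Qed.

Lemma cabs1 : cabs 1 = 1 :> R.
Proof. exact: Normc.normc1. Qed.

Lemma cabs_eq0 x : (cabs x == 0) = (x == 0).
Proof.
by apply/eqP/eqP => [/Normc.eq0_normc //|->]; exact: cabs0.
Qed.

Lemma cabs_gt0 x : (0 < cabs x) = (x != 0).
Proof. by rewrite lt_neqAle eq_sym cabs_eq0 cabs_ge0 andbT. Qed.

Lemma cabsM x y : cabs (x * y) = cabs x * cabs y.
Proof. exact: Normc.normcM. Qed.

Lemma cabsV x : cabs x^-1 = (cabs x)^-1.
Proof. exact: Normc.normcV. Qed.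

Lemma cabsN x : cabs (- x) = cabs x.
Proof. exact: normcN. Qed.

Lemma cabsB x y : cabs (x - y) = cabs (y - x).
Proof. by rewrite -cabsN opprB. Qed.

Lemma cabsD x y : cabs (x + y) <= cabs x + cabs y.
Proof. exact: le_normcD. Qed.

Lemma cabs_sum (I : Type) (s : seq I) (f : I -> R[i]) :
  cabs (\sum_(i <- s) f i) <= \sum_(i <- s) cabs (f i).
Proof.
elim: s => [|i s IH]; first by rewrite !big_nil cabs0.
by rewrite !big_cons (le_trans (cabsD _ _)) // lerD2l.
Qed.

Lemma sqr_cabs x : cabs x ^+ 2 = Re x ^+ 2 + Im x ^+ 2.
Proof. by case: x => a b; rewrite sqr_sqrtr // addr_ge0 ?sqr_ge0. Qed.

Lemma sqr_cabsD x y :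
  cabs (x + y) ^+ 2 = cabs x ^+ 2 + 2 * Re (x^*%C * y) + cabs y ^+ 2.
Proof. by rewrite !sqr_cabs; case: x y => [a b] [c d] /=; ring. Qed.

Lemma ler_Re_cabs x : Re x <= cabs x.
Proof.
have := sqr_ge0 (Im x); have := sqr_cabs x; have := cabs_ge0 x; nra.
Qed.

Lemma norm_Re_cabs x : `|Re x| <= cabs x.
Proof.
rewrite ler_norml lerNl ler_Re_cabs andbT.
by have := ler_Re_cabs (- x); rewrite cabsN; case: x.
Qed.

Lemma conj_cabs x : cabs x^*%C = cabs x.
Proof. by case: x => a b /=; rewrite /cabs /= sqrrN. Qed.

Lemma cabs_real (a : R) : cabs a%:C%C = `|a|.
Proof. by rewrite /cabs /= expr0n addr0 sqrtr_sqr. Qed.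

Lemma ler_cabs_dist x y : cabs x - cabs y <= cabs (x - y).
Proof. by rewrite lerBlDr (le_trans _ (cabsD _ _)) // subrK. Qed.

End Modulus.

Lemma seq_argmin (R : realDomainType) (T : eqType) (F : T -> R) (s : seq T) :
  s != [::] -> exists2 v, v \in s & forall w, w \in s -> F v <= F w.
Proof.
elim: s => // x s IH _; case: (eqVneq s [::]) => [->|/IH[v vs vmin]].
  by exists x => [|w]; rewrite inE // => /eqP->.
have [xv|vx] := leP (F x) (F v).
  exists x => [|w]; rewrite inE ?eqxx // => /orP[/eqP->//|/vmin].
  exact: le_trans.
exists v => [|w]; rewrite inE ?vs ?orbT // => /orP[/eqP->|/vmin //].
exact: ltW.
Qed.


Lemma horner_deriv_prod (F : fieldType) (s : seq F) (u : F) : u \notin s ->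
  (\prod_(x <- s) ('X - x%:P))^`().[u] =
  (\prod_(x <- s) ('X - x%:P)).[u] * \sum_(x <- s) (u - x)^-1.
Proof.
elim: s => [|x t IH]; first by rewrite !big_nil derivE hornerE mulr0.
rewrite inE negb_or => /andP[ux /IH {}IH].
rewrite !big_cons derivM derivXsubC !hornerE IH mulrDr.
by have := ux; rewrite -subr_eq0 => ux0; field.
Qed.

(** With L the logarithmic derivative of the product q, differentiating q' = q L gives q'' = q (L^2
    + L'). *)
Lemma horner_derivn2_prod (F : fieldType) (s : seq F) (u : F) : u \notin s ->
  (\prod_(x <- s) ('X - x%:P))^`(2).[u] =
  (\prod_(x <- s) ('X - x%:P)).[u] *
    ((\sum_(x <- s) (u - x)^-1) ^+ 2 - \sum_(x <- s) (u - x) ^- 2).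
Proof.
elim: s => [|x t IH].
  by rewrite !big_nil /= !derivE hornerE expr0n subrr mulr0.
rewrite inE negb_or => /andP[ux ut]; move: (IH ut) (horner_deriv_prod ut).
rewrite !big_cons /= derivM derivXsubC mul1r derivD derivM derivXsubC mul1r.
rewrite !hornerE => -> ->; rewrite /=.
by have := ux; rewrite -subr_eq0 => ux0; field.
Qed.

Lemma size_zeros (R : realType) (r : {poly R[i]}) :
  r != 0 -> size (zeros r) = (size r).-1.
Proof.
by move=> r0; rewrite [in RHS](zerosE r) size_scale ?lead_coef_eq0 // size_prod_XsubC.
Qed.

(* With v_1, ..., v_m the roots of r, r'/r is the sum of the 1/(u - v_k), each
   of which is at most the reciprocal of the distance from u to the roots. *)
Lemma root_near (R : realType) (r : {poly R[i]}) (u : R[i]) : (1 < size r)%N ->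
  exists2 v, root r v &
    cabs (u - v) * cabs r^`().[u] <= (size r).-1%:R * cabs r.[u].
Proof.
move=> sr; have r0 : r != 0 by rewrite -size_poly_gt0 ltnW.
have [ru|ru] := boolP (root r u).
  by exists u; rewrite // subrr cabs0 mul0r mulr_ge0 ?cabs_ge0 ?ler0n.
have zn : zeros r != [::] by rewrite -size_eq0 size_zeros // -lt0n -subn1 subn_gt0.
have [v vr vmin] := seq_argmin (fun v => cabs (u - v)) zn.
exists v; first by rewrite -mem_zeros.
have uz : u \notin zeros r by rewrite mem_zeros.
have -> : r^`().[u] = r.[u] * \sum_(x <- zeros r) (u - x)^-1.
  by rewrite {1 2}(zerosE r) derivZ !hornerZ horner_deriv_prod // mulrA.
rewrite cabsM mulrCA mulrC; apply: ler_wpM2r; first exact: cabs_ge0.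
rewrite -size_zeros // -sum1_size natr_sum.
apply: le_trans (_ : cabs (u - v) * \sum_(x <- zeros r) (cabs (u - x))^-1 <= _).
  apply: ler_wpM2l; first exact: cabs_ge0.
  by rewrite (le_trans (cabs_sum _ _)) //; apply: ler_sum => x _; rewrite cabsV.
rewrite mulr_sumr big_seq [leRHS]big_seq; apply: ler_sum => x xr.
rewrite ler_pdivrMr ?mul1r ?vmin // cabs_gt0 subr_eq0.
by apply: contraNneq uz => ->.
Qed.

(** * Asymptotics under small displacements of the zeros *)

Section SmallDisplacements.
Variables (R : realType) (n : nat).
Implicit Types (h : 'I_n -> R[i]) (f g : ('I_n -> R[i]) -> R[i]).

(** The bound [d] is kept separate from [h] and need not be the largest |h_i|: it is later taken to
    be a matching distance or a chosen step length. *)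
Definition near0 (P : ('I_n -> R[i]) -> R -> Prop) : Prop :=
  exists2 e, 0 < e &
    forall h d, 0 <= d -> d <= e -> (forall i, cabs (h i) <= d) -> P h d.

Lemma near0W (P Q : ('I_n -> R[i]) -> R -> Prop) :
  (forall h d, 0 <= d -> (forall i, cabs (h i) <= d) -> P h d -> Q h d) ->
  near0 P -> near0 Q.
Proof.
move=> PQ [e e0 eP]; exists e => // h d d0 de hd.
by apply: PQ => //; apply: eP.
Qed.

Lemma near0I (P Q : ('I_n -> R[i]) -> R -> Prop) :
  near0 P -> near0 Q -> near0 (fun h d => P h d /\ Q h d).
Proof.
move=> [a a0 aP] [b b0 bQ]; exists (Num.min a b); first by rewrite lt_min a0.
by move=> h d d0; rewrite le_min => /andP[da db] hd; split; [apply: aP|apply: bQ].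
Qed.

Lemma near0_all (T : eqType) (s : seq T) (P : T -> ('I_n -> R[i]) -> R -> Prop) :
  (forall t, t \in s -> near0 (P t)) ->
  near0 (fun h d => forall t, t \in s -> P t h d).
Proof.
elim: s => [|x s IH] sP; first by exists 1.
have xP : near0 (P x) by apply: sP; rewrite mem_head.
have /IH sP' t : t \in s -> near0 (P t) by move=> ts; apply: sP; rewrite inE ts orbT.
by apply: near0W (near0I xP sP') => h d _ _ [Px Ps] t; rewrite inE => /orP[/eqP->|/Ps].
Qed.

Lemma near0_ltM (C m : R) : 0 <= C -> 0 < m -> near0 (fun _ d => C * d < m).
Proof.
move=> C0 m0; have C1 : 0 < 2 * (C + 1) by lra.
exists (m / (2 * (C + 1))) => [|h d d0]; first exact: divr_gt0.
by rewrite ler_pdivlMr // => + _; nra.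
Qed.

Definition bigO k f : Prop :=
  exists2 C, 0 <= C & near0 (fun h d => cabs (f h) <= C * d ^+ k).

Lemma bigOD k f g : bigO k f -> bigO k g -> bigO k (fun h => f h + g h).
Proof.
move=> [C C0 fC] [D D0 gD]; exists (C + D); first exact: addr_ge0.
apply: near0W (near0I fC gD) => h d _ _ [fh gh].
by rewrite (le_trans (cabsD _ _)) // mulrDl lerD.
Qed.

Lemma bigOM k l f g : bigO k f -> bigO l g -> bigO (k + l) (fun h => f h * g h).
Proof.
move=> [C C0 fC] [D D0 gD]; exists (C * D); first exact: mulr_ge0.
apply: near0W (near0I fC gD) => h d _ _ [fh gh].
by rewrite cabsM exprD mulrACA ler_pM ?cabs_ge0.
Qed.

Lemma bigO_cst c : bigO 0 (fun=> c).
Proof.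
by exists (cabs c); [exact: cabs_ge0|exists 1 => // h d *; rewrite expr0 mulr1].
Qed.

Lemma bigO_coord i : bigO 1 (fun h => h i).
Proof. by exists 1 => //; exists 1 => // h d _ _; rewrite expr1 mul1r. Qed.

Lemma bigO_scale k c f : bigO k f -> bigO k (fun h => c * f h).
Proof. exact: (bigOM (bigO_cst c)). Qed.

Lemma bigO_sum k (I : Type) (s : seq I) (F : I -> ('I_n -> R[i]) -> R[i]) :
  (forall i, bigO k (F i)) -> bigO k (fun h => \sum_(i <- s) F i h).
Proof.
move=> FO; elim: s => [|i s [C C0 IH]].
  by exists 0 => //; exists 1 => // h d *; rewrite big_nil cabs0 mul0r.
have [D D0 iD] := bigOD (FO i) (ex_intro2 _ _ C C0 IH).
by exists D => //; apply: near0W iD => h d _ _; rewrite big_cons.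
Qed.

Lemma bigO1_lt f m : bigO 1 f -> 0 < m -> near0 (fun h _ => cabs (f h) < m).
Proof.
move=> [C C0 fC] m0; apply: near0W (near0I fC (near0_ltM C0 m0)) => h d _ _ [].
by rewrite expr1; apply: le_lt_trans.
Qed.

(** Order 0 means boundedness. For small d one has |f(h)| < |c|/2, which keeps |c + f(h)| at least
    |c|/2. *)
Lemma bigO_inv c f : c != 0 -> bigO 1 f -> bigO 0 (fun h => (c + f h)^-1).
Proof.
rewrite -cabs_gt0 => c0 fO; exists (2 / cabs c); first by rewrite divr_ge0 ?ltW.
have c2 : 0 < cabs c / 2 by lra.
apply: near0W (bigO1_lt fO c2) => h d _ _ fc.
have cf : cabs c / 2 <= cabs (c + f h).
  by have := ler_cabs_dist c (- f h); rewrite cabsN opprK; lra.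
by rewrite expr0 mulr1 cabsV -[2 / _]invf_div lef_pV2 ?posrE // (lt_le_trans c2).
Qed.

End SmallDisplacements.
Arguments bigO_cst {R n} c.
Arguments bigO_coord {R n} i.
Arguments near0_ltM {R} n [C m].

(** * Products of linear factors indexed by ['I_n] *)

Section Products.
Variables (n : nat).

Lemma horner_deriv_prod_ord (F : fieldType) (z : 'I_n -> F) u :
  (forall i, u != z i) ->
  (\prod_i ('X - (z i)%:P))^`().[u] =
  (\prod_i ('X - (z i)%:P)).[u] * \sum_i (u - z i)^-1.
Proof.
move=> uz; have us : u \notin map z (index_enum 'I_n).
  by apply/mapP => -[i _ ui]; have := uz i; rewrite ui eqxx.
by have := horner_deriv_prod us; rewrite !big_map.
Qed.

Lemma horner_derivn2_prod_ord (F : fieldType) (z : 'I_n -> F) u :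
  (forall i, u != z i) ->
  (\prod_i ('X - (z i)%:P))^`(2).[u] =
  (\prod_i ('X - (z i)%:P)).[u] *
    ((\sum_i (u - z i)^-1) ^+ 2 - \sum_i (u - z i) ^- 2).
Proof.
move=> uz; have us : u \notin map z (index_enum 'I_n).
  by apply/mapP => -[i _ ui]; have := uz i; rewrite ui eqxx.
by have := horner_derivn2_prod us; rewrite !big_map.
Qed.

Lemma root_prod_ord (F : idomainType) (z : 'I_n -> F) u :
  root (\prod_i ('X - (z i)%:P)) u = [exists i, u == z i].
Proof.
have -> : \prod_i ('X - (z i)%:P) = \prod_(x <- map z (index_enum 'I_n)) ('X - x%:P).
  by rewrite big_map.
rewrite root_prod_XsubC; apply/mapP/existsP => [[j _ ->]|[j /eqP ->]]; exists j => //.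
by rewrite mem_index_enum.
Qed.

Lemma size_prod_ord (F : idomainType) (z : 'I_n -> F) :
  size (\prod_i ('X - (z i)%:P)) = n.+1.
Proof. by rewrite size_prod_XsubC -sum1_size big_const_ord iter_addn_0 mul1n. Qed.

End Products.

(** In characteristic zero the leading coefficient of a nonconstant polynomial is multiplied by a
    nonzero integer. *)
Lemma size_deriv_num (F : numDomainType) (q : {poly F}) : size q^`() = (size q).-1.
Proof.
have [->|q0] := eqVneq q 0; first by rewrite deriv0 size_poly0.
apply/eqP; rewrite eqn_leq -ltnS prednK ?size_poly_gt0 // lt_size_deriv //=.
case sq: (size q) => [|[|m]] //=; rewrite ltnNge; apply: contraNN q0 => /leq_sizeP.
move=> /(_ m (leqnn m)); rewrite coef_deriv => /eqP.
by rewrite mulrn_eq0 /= -lead_coef_eq0 lead_coefE sq.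
Qed.

Lemma bigO_le (R : realType) n k l (f : ('I_n -> R[i]) -> R[i]) :
  (l <= k)%N -> bigO k f -> bigO l f.
Proof.
move=> lk [C C0 fC]; exists C => //.
apply: near0W (near0I fC (near0_ltM n ler01 ltr01)) => h d d0 _ [/le_trans + d1].
by apply; rewrite ler_wpM2l // ler_wiXn2l //; move: d1; rewrite mul1r => /ltW.
Qed.

(** In the application D is w - z_l, x its relative first-order change and r a second-order error.
    Beyond |D|^2 (1 + 2 Re x), every term of the square contains |x|^2 or r. *)
Lemma sqr_cabs_expand (R : realType) (D x r : R[i]) (A B d : R) :
  0 <= d -> d <= 1 -> 0 <= B -> 0 <= A -> cabs x <= A * d -> cabs r <= B * d ^+ 2 ->
  `|cabs (D * (1 + x) + r) ^+ 2 - cabs D ^+ 2 * (1 + 2 * Re x)| <=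
    (cabs D ^+ 2 * A ^+ 2 + 2 * (cabs D * (1 + A) * B) + B ^+ 2) * d ^+ 2.
Proof.
move=> d0 d1 B0 A0 xd rd.
rewrite sqr_cabsD cabsM exprMn (sqr_cabsD 1 x) conjc1 mul1r cabs1 expr1n.
set y := (D * _)^*%C * r.
have -> : cabs D ^+ 2 * (1 + 2 * Re x + cabs x ^+ 2) + 2 * Re y + cabs r ^+ 2 -
    cabs D ^+ 2 * (1 + 2 * Re x) = cabs D ^+ 2 * cabs x ^+ 2 + 2 * Re y + cabs r ^+ 2.
  by ring.
have Ad : A * d <= A by rewrite ler_piMr.
have yd : cabs y <= cabs D * (1 + A) * B * d ^+ 2.
  rewrite cabsM conj_cabs cabsM -[leRHS]mulrA ler_pM ?mulr_ge0 ?cabs_ge0 //.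
  rewrite ler_wpM2l ?cabs_ge0 // (le_trans (cabsD _ _)) // cabs1 lerD2l.
  exact: le_trans xd Ad.
have xd2 : cabs D ^+ 2 * cabs x ^+ 2 <= cabs D ^+ 2 * A ^+ 2 * d ^+ 2.
  rewrite -mulrA ler_wpM2l ?sqr_ge0 // -exprMn lerXn2r ?nnegrE ?cabs_ge0 //.
  exact: mulr_ge0.
have rd2 : cabs r ^+ 2 <= B ^+ 2 * d ^+ 2.
  rewrite -exprMn lerXn2r ?nnegrE ?cabs_ge0 ?mulr_ge0 // (le_trans rd) //.
  by rewrite ler_wpM2l // expr2 ler_piMl.
rewrite (le_trans (ler_normD _ _)) // (le_trans (lerD (ler_normD _ _) (lexx _))) //.
have Dx0 : 0 <= cabs D ^+ 2 * cabs x ^+ 2 by rewrite mulr_ge0 ?sqr_ge0.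
rewrite (ger0_norm Dx0) (ger0_norm (sqr_ge0 _)) normrM ger0_norm //.
by have := norm_Re_cabs y; rewrite !mulrDl; lra.
Qed.

(** * First-order motion of one critical point *)

Section CriticalPoints.
Variables (R : realType) (n : nat) (z : 'I_n -> R[i]) (w : R[i]).
Let p := \prod_i ('X - (z i)%:P).
Let q (h : 'I_n -> R[i]) := \prod_i ('X - (z i + h i)%:P).
Hypotheses (n1 : (1 < n)%N) (pw : ~~ root p w) (p1w : root p^`() w)
  (p2w : ~~ root p^`(2) w).

Let c i := w - z i.
Let S := \sum_i c i ^- 2.
(* The first-order displacement of w when each zero z i moves to z i + h i. *)
Let shift h := S^-1 * \sum_i c i ^- 2 * h i.

Let wz i : w != z i.
Proof.
by apply: contraNneq pw => ->; rewrite root_prod_ord; apply/existsP; exists i.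
Qed.

Let c0 i : c i != 0.
Proof. by rewrite subr_eq0. Qed.

Let sum_inv : \sum_i (c i)^-1 = 0.
Proof.
move/rootP: p1w => /eqP; rewrite horner_deriv_prod_ord // mulf_eq0 -rootE.
by rewrite (negPf pw) => /eqP.
Qed.

Let p2E : p^`(2).[w] = - (p.[w] * S).
Proof. by rewrite horner_derivn2_prod_ord // sum_inv expr0n sub0r mulrN. Qed.

(** Since p''(w) = - p(w) S, this expresses that w is a simple critical point; it is what makes
    [shift] meaningful. *)
Let S0 : S != 0.
Proof. by apply: contraNneq p2w => S0; rewrite rootE p2E S0 mulr0 oppr0. Qed.

Let shiftO : bigO 1 shift.
Proof. by apply: bigO_scale; apply: bigO_sum => i; apply/bigO_scale/bigO_coord. Qed.

(** The change of w - z_i predicted to first order. *)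
Let e i h := shift h - h i.

Let eO i : bigO 1 (e i).
Proof.
have [K K0 KP] := bigOD shiftO (bigO_scale (-1) (bigO_coord i)).
by exists K => //; apply: near0W KP => h d _ _; rewrite mulN1r.
Qed.

Lemma crit_shift : exists2 K, 0 <= K & near0 (fun h d =>
  exists2 v, root (q h)^`() v & cabs (w + shift h - v) <= K * d ^+ 2).
Proof.
(* This is q'/q at u = w + shift h, written so that its quadratic size is visible. *)
pose f h := \sum_i (e i h * e i h) * (c i ^- 2 * (c i + e i h)^-1).
have fO : bigO 2 f.
  apply: bigO_sum => i; apply: (@bigOM _ _ 2 0); first exact: (@bigOM _ _ 1 1).
  by apply/bigO_scale/bigO_inv.
(* The change of the sum S of inverse squares when each c_i becomes c_i + e_i. *)
pose g h := \sum_i e i h * (- c i ^- 2 * ((c i + c i + e i h) *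
              ((c i + e i h)^-1 * (c i + e i h)^-1))).
have gO : bigO 1 g.
  apply: bigO_sum => i; apply: (@bigOM _ _ 1 0) => //; apply: bigO_scale.
  apply: (@bigOM _ _ 0 0).
    by apply: (bigOD (bigO_cst _)); apply: bigO_le (eO i).
  by apply: (@bigOM _ _ 0 0); apply: bigO_inv.
(* At u, q''/q is f^2 - (S + g), so its modulus is at least |S|/2 once |g - f^2| < |S|/2. *)
have GO : bigO 1 (fun h => g h + -1 * (f h * f h)).
  apply: bigOD => //; apply/bigO_scale/(@bigO_le _ _ 4) => //.
  exact: (@bigOM _ _ 2 2).
case: fO => F F0 fF; have S20 : 0 < cabs S / 2 by rewrite divr_gt0 ?cabs_gt0.
have /near0_all eN i : i \in index_enum 'I_n ->
    near0 (fun h _ => cabs (e i h) < cabs (c i)).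
  by move=> _; apply: bigO1_lt => //; rewrite cabs_gt0.
(* [root_near] for q' bounds |u - v| |q''/q| by (n - 1) |q'/q|; here |q'/q| <= F d^2 and |q''/q| >=
   |S|/2. *)
exists (n%:R * F * (cabs S / 2)^-1).
  by rewrite divr_ge0 ?(ltW S20) // mulr_ge0.
apply: near0W (near0I eN (near0I fF (bigO1_lt GO S20))) => h d d0 _ [ec [fd Gd]].
have ce i : c i + e i h != 0.
  apply: contraTneq (ec i (mem_index_enum i)) => /eqP.
  by rewrite addr_eq0 => /eqP ->; rewrite cabsN ltxx.
set u := w + shift h.
have uE i : u - (z i + h i) = c i + e i h by rewrite /u /c /e; ring.
have uz i : u != z i + h i by rewrite -subr_eq0 uE.
have sf : \sum_i (u - (z i + h i))^-1 = f h.
  (* Termwise, 1/(c + e) = 1/c - e/c^2 + e^2/(c^2 (c + e)). The sum of the 1/c_i vanishes since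
     p'(w) = 0, and that of the e_i/c_i^2 by the choice of [shift]. *)
  have -> : f h = \sum_i ((u - (z i + h i))^-1 - (c i)^-1
                     + (S^-1 * (c i ^- 2 * \sum_i c i ^- 2 * h i) - c i ^- 2 * h i)).
    apply: eq_bigr => i _; rewrite uE.
    have -> : S^-1 * (c i ^- 2 * \sum_i c i ^- 2 * h i) - c i ^- 2 * h i
            = c i ^- 2 * e i h by rewrite /e /shift; ring.
    move: (e i h) (ce i) (c0 i) => x cx c1; field; exact/andP.
  rewrite !big_split /= !sumrN sum_inv subr0 -mulr_sumr -mulr_suml -/S.
  by rewrite mulrA mulVf // mul1r subrr addr0.
have sg : \sum_i (u - (z i + h i)) ^- 2 = S + g h.
  rewrite -big_split; apply: eq_bigr => i _ /=; rewrite uE.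
  move: (e i h) (ce i) (c0 i) => x cx c1; field; exact/andP.
have sq : size (q h)^`() = n by rewrite size_deriv_num size_prod_ord.
have [|v qv vle] := @root_near R (q h)^`() u; first by rewrite sq.
exists v => //; move: vle; rewrite sq horner_deriv_prod_ord // sf.
rewrite (_ : (q h)^`()^`() = (q h)^`(2)) // horner_derivn2_prod_ord // sf sg !cabsM.
have q0 : 0 < cabs (q h).[u].
  rewrite cabs_gt0 -rootE root_prod_ord; apply/existsP => -[j].
  by rewrite (negPf (uz j)).
rewrite mulrCA [leRHS]mulrCA ler_pM2l // => vle.
rewrite -[leRHS]mulrAC ler_pdivlMr //.
apply: le_trans (_ : cabs (u - v) * cabs (f h ^+ 2 - (S + g h)) <= _).
  rewrite ler_wpM2l ?cabs_ge0 // cabsB.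
  have := ler_cabs_dist S (- (g h + -1 * (f h * f h))); rewrite cabsN opprK.
  rewrite (_ : S + g h - f h ^+ 2 = S + (g h + -1 * (f h * f h))); last by ring.
  by lra.
apply: le_trans vle _; rewrite -mulrA ler_pM ?cabs_ge0 ?ler_nat ?leq_pred //.
Qed.

Lemma crit_expand l : exists2 K, 0 <= K & near0 (fun h d => exists v,
  [/\ root (q h)^`() v, cabs (w - v) <= K * d &
   `|cabs (v - (z l + h l)) ^+ 2 - cabs (w - z l) ^+ 2 *
       (1 + 2 * Re (\sum_i alpha_coef p z l w i * h i))| <= K * d ^+ 2]).
Proof.
pose X h := \sum_i alpha_coef p z l w i * h i.
(* This explains the coefficients alpha_i: they give the relative first-order change of w - z_l,
   once p''(w) is replaced by - p(w) S. *)
have DX h : (w - z l) * X h = shift h - h l.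
  have hl : h l = \sum_i (if i == l then h i else 0).
    by rewrite -big_mkcond big_pred1_eq.
  rewrite [in RHS]hl /shift !mulr_sumr -sumrB; apply: eq_bigr => i _.
  have pw0 : p.[w] != 0 by [].
  have := c0 l; rewrite /alpha_coef p2E /c; case: (i =P l) => [->|_] cl.
    field; exact/and3P.
  rewrite subr0 -/(c i); field; apply/and4P; split => //; exact: c0.
have [A A0 AP] : bigO 1 X.
  by apply: bigO_sum => i; apply: bigO_scale; exact: bigO_coord.
case: shiftO => C C0 CP; case: crit_shift => B B0 BP.
set D := w - z l; pose M := cabs D ^+ 2 * A ^+ 2 + 2 * (cabs D * (1 + A) * B) + B ^+ 2.
have cD := cabs_ge0 D.
have M0 : 0 <= M by rewrite /M !addr_ge0 ?mulr_ge0 ?addr_ge0 ?sqr_ge0 ?ler0n.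
exists (M + B + C); first by rewrite addr_ge0 // addr_ge0.
apply: near0W (near0I (near0I AP CP) (near0I BP (near0_ltM n ler01 ltr01))).
move=> h d d0 _ [[Xd sd] [[v qv vd] d1]]; rewrite mul1r in d1.
exists v; split => //.
  have -> : w - v = (w + shift h - v) - shift h by ring.
  rewrite (le_trans (cabsD _ _)) // cabsN [leRHS]mulrDl [(M + B) * d]mulrDl.
  have Md : 0 <= M * d by rewrite mulr_ge0.
  have Bd : B * d ^+ 2 <= B * d by rewrite ler_wpM2l // expr2 ler_piMl // ltW.
  apply: lerD; last by move: sd; rewrite expr1.
  by rewrite (le_trans vd) // (le_trans Bd) // lerDr.
have vE : v - (z l + h l) = D * (1 + X h) + (v - (w + shift h)).
  by rewrite mulrDr DX /D; ring.
rewrite vE; apply: le_trans (sqr_cabs_expand D d0 (ltW d1) B0 A0 _ _) _.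
- by move: Xd; rewrite expr1.
- by rewrite cabsB; exact: vd.
- rewrite ler_wpM2r ?sqr_ge0 // -/M -addrA lerDl; exact: addr_ge0.
Qed.

End CriticalPoints.

Lemma simple_zero_deriv (R : realType) (r : {poly R[i]}) x :
  simple_zeros r -> r != 0 -> root r x -> ~~ root r^`() x.
Proof.
move=> rs r0 rx; apply/negP => r'x; have := rs x rx.
suff : (1 < mup x r)%N by move=> + mx; rewrite mx.
rewrite mup_geq //; case/factor_theorem: rx r'x => s ->.
rewrite derivM derivXsubC mulr1 rootE !hornerE subrr mulr0 add0r => sx.
by case/factor_theorem: sx => s' ->; rewrite -mulrA -expr2 dvdp_mulIr.
Qed.

(** * Distances to the critical points and their maximum *)

Section CriticalDistance.
Variables (R : realType) (p : {poly R[i]}) (a : R[i]).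

Lemma crit_dist_le w : w \in zeros p^`() -> crit_dist p a <= cabs (a - w).
Proof.
move=> wp; rewrite /crit_dist.
exact: (@ge_bigmin_seq _ _ _ _ _ w xpredT (fun w => cabs (a - w))).
Qed.

Lemma crit_dist_attained : zeros p^`() != [::] ->
  exists2 w, w \in zeros p^`() & crit_dist p a = cabs (a - w).
Proof.
move=> z0; rewrite /crit_dist big_seq.
elim/big_ind: _ => [|_ _ [u up ->] [v vp ->]|w wp]; last by exists w.
  by exists (zeros p^`())`_0; rewrite ?mem_nth // lt0n size_eq0.
by case: leP => _; [exists u|exists v].
Qed.

Lemma crit_dist_ge0 : zeros p^`() != [::] -> 0 <= crit_dist p a.
Proof. by move=> /crit_dist_attained[w _ ->]; exact: cabs_ge0. Qed.

End CriticalDistance.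

Lemma le_dmax (R : realType) (p : {poly R[i]}) z :
  z \in zeros p -> crit_dist p z <= dmax p.
Proof.
move=> zp; rewrite /dmax.
exact: (@le_bigmax_seq _ _ _ _ _ z xpredT (crit_dist p)).
Qed.

Lemma dmax_le (R : realType) (p : {poly R[i]}) (B : R) :
  0 <= B -> (forall z, z \in zeros p -> crit_dist p z <= B) -> dmax p <= B.
Proof.
move=> B0 pB; rewrite /dmax big_seq.
by elim/big_ind: _ => // x y xB yB; rewrite ge_max xB.
Qed.

Section UniformConstants.
Variables (R : realType) (n : nat).

(** The constants of finitely many statements are added up; each statement only weakens as its
    constant grows. *)
Lemma near0_uniform (T : eqType) (s : seq T)
    (P : T -> R -> ('I_n -> R[i]) -> R -> Prop) :
  (forall t K K' h d, 0 <= d -> K <= K' -> P t K h d -> P t K' h d) ->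
  (forall t, t \in s -> exists2 K, 0 <= K & near0 (P t K)) ->
  exists2 K, 0 <= K & near0 (fun h d => forall t, t \in s -> P t K h d).
Proof.
move=> Pmono sP.
suff [K K0 KP] : exists2 K, 0 <= K & forall t, t \in s -> near0 (P t K).
  by exists K => //; exact: near0_all.
elim: s sP => [|x s IH] sP; first by exists 0.
have [|K K0 KP] := IH; first by move=> t ts; apply: sP; rewrite inE ts orbT.
have [|L L0 LP] := sP x; first by rewrite mem_head.
exists (K + L) => [|t]; first exact: addr_ge0.
rewrite inE => /orP[/eqP->|/KP]; last first.
  by apply: near0W => h d d0 _; apply: Pmono; rewrite ?lerDl.
by apply: near0W LP => h d d0 _; apply: Pmono; rewrite ?lerDr.
Qed.

End UniformConstants.

(** * Continuation of all critical points at once *)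

Section Tracking.
Variables (R : realType) (n : nat) (z : 'I_n -> R[i]).
Let p := \prod_i ('X - (z i)%:P).
Let q (h : 'I_n -> R[i]) := \prod_i ('X - (z i + h i)%:P).
Hypotheses (n1 : (1 < n)%N) (ps : simple_zeros p) (p's : simple_zeros p^`()).

(* v is the critical point of q h that continues the critical point w of p. *)
Definition tracks (l : 'I_n) (w : R[i]) (K : R) (h : 'I_n -> R[i]) (d : R) (v : R[i]) :=
  [/\ root (q h)^`() v, cabs (w - v) <= K * d &
   `|cabs (v - (z l + h l)) ^+ 2 - cabs (w - z l) ^+ 2 *
       (1 + 2 * Re (\sum_i alpha_coef p z l w i * h i))| <= K * d ^+ 2].

Let size_p' : size p^`() = n.
Proof. by rewrite size_deriv_num size_prod_ord. Qed.

Let size_q' h : size (q h)^`() = n.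
Proof. by rewrite size_deriv_num size_prod_ord. Qed.

Let p0 : p != 0. Proof. by rewrite -size_poly_gt0 size_prod_ord. Qed.
Let p'0 : p^`() != 0. Proof. by rewrite -size_poly_gt0 size_p' ltnW. Qed.

Let uniq_zeros : uniq (zeros p^`()).
Proof.
apply: count_mem_uniq => x; have [xp|/count_memPn //] := boolP (x \in zeros p^`()).
rewrite -mu_prod_XsubC -[RHS](p's (x := x)) -?mem_zeros // [in RHS](zerosE p^`()).
by rewrite -mul_polyC mupMr // rootC lead_coef_eq0.
Qed.

(** The second half, needed for lower bounds on a minimum over all roots of q', follows by counting:
    distinct critical points of p have distinct continuations, and these exhaust the n - 1 roots of
    q'. *)
Lemma crit_track l : exists2 K, 0 <= K & near0 (fun h d =>
  (forall w, w \in zeros p^`() -> exists v, tracks l w K h d v) /\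
  (forall v, root (q h)^`() v -> exists2 w, w \in zeros p^`() & tracks l w K h d v)).
Proof.
have [|w wp'|K K0 KP] := @near0_uniform R n _ (zeros p^`())
    (fun w K h d => exists v, tracks l w K h d v).
- move=> w K K' h d d0 KK' [v [qv vw vd]]; exists v; split=> //.
    by rewrite (le_trans vw) // ler_wpM2r.
  by rewrite (le_trans vd) // ler_wpM2r // exprn_ge0.
- have rw : root p^`() w by rewrite -mem_zeros.
  apply: crit_expand => //; last exact: (simple_zero_deriv p's p'0 rw).
  by apply: contraTN rw; apply: simple_zero_deriv.
exists K => //.
have K2 : 0 <= 2 * K by lra.
(* Disks of radius K d about distinct critical points of p are disjoint for small d. *)
have /near0_all sep (w : R[i]) : w \in zeros p^`() -> near0 (fun (h : 'I_n -> R[i]) d =>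
    forall w', w' \in [seq w' <- zeros p^`() | w' != w] -> 2 * K * d < cabs (w - w')).
  move=> _; apply: near0_all => w'; rewrite mem_filter => /andP[w'w _].
  by apply: near0_ltM; rewrite // cabs_gt0 subr_eq0 eq_sym.
apply: near0W (near0I KP sep) => h d d0 _ [{}KP {}sep]; split=> // v qv.
have /boolp.choice[f fP] (w : R[i]) : exists v, w \in zeros p^`() -> tracks l w K h d v.
  by have [/KP[v' ?]|_] := boolP (w \in zeros p^`()); [exists v'|exists 0].
have f_inj : {in zeros p^`() &, injective f}.
  move=> w w' wp wp' fw; apply/eqP; rewrite eq_sym; apply: contraT => ww'.
  have := sep _ wp w'; rewrite mem_filter ww' => /(_ wp').
  have [_ d1 _] := fP _ wp; have [_ d2 _] := fP _ wp'.
  have := cabsD (w - f w) (f w' - w').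
  rewrite -fw addrA subrK [cabs (f w - w')]cabsB fw.
  by rewrite -fw in d2 *; lra.
have q'0 : (q h)^`() != 0 by rewrite -size_poly_gt0 size_q' ltnW.
have fu : uniq (map f (zeros p^`())) by rewrite map_inj_in_uniq.
suff : v \in map f (zeros p^`()) by case/mapP => w wp ->; exists w => //; exact: fP.
apply: contraT => vf.
have : (size (v :: map f (zeros p^`())) < size (q h)^`())%N.
  apply: max_poly_roots => //=; last by rewrite vf.
  by rewrite qv; apply/allP => _ /mapP[w wp ->]; case: (fP _ wp).
by rewrite /= size_map size_zeros // size_p' size_q' prednK ?ltnn // ltnW.
Qed.

End Tracking.

(** * The matching distance and positive singularity *)

Section ZeroListings.
Variables (R : realType) (n : nat).
Implicit Types (z zeta : 'I_n -> R[i]) (q : {poly R[i]}).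

(** Unique factorization ties the unspecified order of [zeros] to a given labelling. *)
Lemma zeros_prod_ord z :
  exists s : 'S_n, forall i : 'I_n, (zeros (\prod_i ('X - (z i)%:P)))`_i = z (s i).
Proof.
set p := \prod_i _; have pm : p \is monic by exact: monic_prod_XsubC.
have : perm_eq (zeros p) [tuple z i | i < n].
  apply: prod_XsubC_eq; rewrite big_tuple.
  rewrite -[LHS]scale1r -(monicP pm) -zerosE; apply: eq_bigr => i _.
  by rewrite tnth_mktuple.
case/tuple_permP => s zE; exists s => i.
by rewrite zE (nth_map i) ?size_enum_ord // nth_ord_enum !tnth_mktuple.
Qed.

Lemma in_S_prod q : in_S n q -> q = \prod_(i < n) ('X - ((zeros q)`_i)%:P).
Proof.
move=> [qm sq _]; rewrite [LHS]zerosE (monicP qm) scale1r (big_nth 0) big_mkord.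
by rewrite size_zeros ?monic_neq0 // sq.
Qed.

Lemma Delta_le z zeta (d : R) : 0 <= d -> (forall i, cabs (zeta i - z i) <= d) ->
  Delta n (\prod_i ('X - (zeta i)%:P)) (\prod_i ('X - (z i)%:P)) <= d.
Proof.
move=> d0 zd; have [s sE] := zeros_prod_ord z; have [r rE] := zeros_prod_ord zeta.
(* Permutations compose from left to right, so this one pairs zeta_j with z_j. *)
rewrite /Delta; apply: (@bigmin_inf _ _ _ _ (r * s^-1)%g) => //.
by apply: bigmax_le => // i _; rewrite rE sE permM permKV.
Qed.

(** Relabelling the zeros of q along an optimal permutation turns closeness in [Delta] into a
    displacement of the z_i. *)
Lemma Delta_displacement z q : in_S n q -> exists zeta,
  [/\ q = \prod_i ('X - (zeta i)%:P), 0 <= Delta n q (\prod_i ('X - (z i)%:P)) &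
   forall i, cabs (zeta i - z i) <= Delta n q (\prod_i ('X - (z i)%:P))].
Proof.
move=> qS; set p := \prod_i _; have [s sE] := zeros_prod_ord z.
pose dist (s : 'S_n) : R :=
  \big[Num.max/0]_(i < n) cabs ((zeros q)`_i - (zeros p)`_(s i)).
have [r rE] : exists r, Delta n q p = dist r.
  rewrite /Delta; elim/big_ind: _ => [|_ _ [a ->] [b ->]|a _]; last by exists a.
    by exists 1%g.
  by case: leP => _; [exists a|exists b].
exists (fun j => (zeros q)`_((s^-1 * r^-1)%g j)); rewrite rE; split => [||j].
- by rewrite {1}(in_S_prod qS) (reindex_inj (@perm_inj _ (s^-1 * r^-1)%g)).
- exact: bigmax_ge_id.
- rewrite /dist; apply: le_trans (le_bigmax _ _ ((s^-1 * r^-1)%g j)).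
  by rewrite sE permM !permKV.
Qed.

End ZeroListings.

Section ReSum.
Variable R : realType.

Lemma Re_sum (I : Type) (s : seq I) (P : pred I) (F : I -> R[i]) :
  Re (\sum_(i <- s | P i) F i) = \sum_(i <- s | P i) Re (F i).
Proof. by apply: (@big_morph R R[i] (@Re R) 0 +%R 0 +%R) => // -[a b] [c d]. Qed.

Lemma Im_sum (I : Type) (s : seq I) (P : pred I) (F : I -> R[i]) :
  Im (\sum_(i <- s | P i) F i) = \sum_(i <- s | P i) Im (F i).
Proof. by apply: (@big_morph R R[i] (@Im R) 0 +%R 0 +%R) => // -[a b] [c d]. Qed.

Lemma Re_realM (a : R) x : Re (a%:C%C * x) = a * Re x.
Proof. by case: x => b c /=; rewrite mul0r subr0. Qed.

Lemma Im_realM (a : R) x : Im (a%:C%C * x) = a * Im x.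
Proof. by case: x => b c /=; rewrite mul0r addr0. Qed.

End ReSum.

(** Gordan's alternative over the reals, with each complex coordinate split in two; the minus sign
    comes from Re(ab) = Re a Re b - Im a Im b. *)
Lemma positively_singularPn (R : realType) m n (M : 'M[R[i]]_(m, n)) :
  positively_singular M \/
  exists g : 'I_n -> R[i], forall i, 0 < Re (\sum_j M i j * g j).
Proof.
pose v i (t : 'I_n + 'I_n) :=
  match t with inl j => Re (M i j) | inr j => - Im (M i j) end.
have [[mu [mu0 mun muv]]|[h hP]] := gordan v; [left|right].
  exists mu; split => // j; apply/eqP; rewrite eq_complex Re_sum Im_sum.
  have := muv (inl j); have /eqP := muv (inr j).
  under eq_bigr do rewrite mulrN.
  rewrite sumrN oppr_eq0 => /eqP muI muR.
  by rewrite (eq_bigr _ (fun i _ => Re_realM _ _)) muR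
             (eq_bigr _ (fun i _ => Im_realM _ _)) muI !eqxx.
exists (fun j => (h (inl j) +i* h (inr j))%C) => i.
have := hP i; rewrite big_sumType /= -big_split Re_sum /=.
congr (0 < _); apply: eq_bigr => j _.
by case: (M i j) => a b /=; rewrite mulNr.
Qed.

Section Weights.
Variables (R : realType) (n : nat) (p : {poly R[i]}) (z : 'I_n -> R[i]) (l : 'I_n).
Let ws := near_crit p (z l).

Lemma mem_near_crit w :
  w \in ws -> w \in zeros p^`() /\ cabs (w - z l) = crit_dist p (z l).
Proof. by rewrite mem_filter => /andP[/eqP]. Qed.

(** The column relations rewrite the weighted sum as a nonnegative combination of the Re(conj(z_s)
    h_s) over the zeros z_s on the circle. *)
Lemma positively_singular_weights : positively_singular (Amx p z l) ->
  exists nu : 'I_(size ws) -> R, [/\ forall k, 0 <= nu k, 0 < \sum_k nu k &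
    forall h : 'I_n -> R[i],
      (forall i, cabs (z i) = 1 -> Re ((z i)^*%C * h i) <= 0) ->
      \sum_k nu k * Re (\sum_i alpha_coef p z l ws`_k i * h i) <= 0].
Proof.
move=> [mu [mu0 [i0 mui0] muA]].
pose nu k := mu (lshift _ k); pose xi (k : 'I_#|unit_idx z|) := mu (rshift (size ws) k).
have col j : \sum_k (nu k)%:C%C * alpha_coef p z l ws`_k j =
             \sum_k if j == enum_val k then (xi k)%:C%C * (z j)^*%C else 0.
  move: (muA j); rewrite big_split_ord /= => /eqP; rewrite addr_eq0 => /eqP.
  under eq_bigr do rewrite /Amx col_mxEu mxE.
  under [X in _ = - X]eq_bigr do rewrite /Amx col_mxEd mxE.
  move=> ->; rewrite -sumrN; apply: eq_bigr => k _.
  by case: ifP => _; rewrite ?mulr0 ?oppr0 // mulrN opprK.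
have unit_z (k : 'I_#|unit_idx z|) : cabs (z (enum_val k)) = 1.
  by have := enum_valP k; rewrite inE => /eqP.
exists nu; split => [k|| h hz]; first exact: mu0.
- rewrite lt_neqAle eq_sym sumr_ge0 ?andbT => [|k _]; last exact: mu0.
  apply: contraNneq mui0 => /eqP; rewrite psumr_eq0 => [|k _]; last exact: mu0.
  move=> /allP nu0; have {}nu0 k : nu k = 0 by apply/eqP/nu0; rewrite mem_index_enum.
  rewrite -(splitK i0); case: (split i0) => k /=; first by apply/eqP/nu0.
  (* If all nu_k vanish, column s_k retains only the k-th circle row; as z_{s_k} is nonzero, the
     weight of that row vanishes too, contradicting that mu is nonzero. *)
  have := col (enum_val k); rewrite big1 => [|k' _]; last by rewrite nu0 mul0r.
  rewrite (bigD1 k) //= eqxx big1 ?addr0 => [|k' k'k]; last first.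
    by rewrite (inj_eq enum_val_inj) eq_sym (negPf k'k).
  move=> /esym/eqP; rewrite mulf_eq0 conjc_eq0 -(cabs_eq0 (z _)) unit_z oner_eq0 orbF.
  by rewrite eq_complex eqxx andbT.
- rewrite (eq_bigr _ (fun k _ => esym (Re_realM _ _))) -Re_sum.
  under eq_bigr do rewrite mulr_sumr.
  rewrite exchange_big /=.
  under eq_bigr => j _.
    under eq_bigr do rewrite mulrA.
    rewrite -mulr_suml col mulr_suml.
    over.
  rewrite exchange_big /= Re_sum; apply: sumr_le0 => k _.
  rewrite (bigD1 (enum_val k)) //= eqxx big1 ?addr0 => [|j jk]; last first.
    by rewrite (negPf jk) mul0r.
  by rewrite -mulrA Re_realM mulr_ge0_le0 ?mu0 // hz.
Qed.

End Weights.

(** * The two implications *)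

Lemma Re_conj_le0 (R : realType) (a h : R[i]) :
  cabs a = 1 -> cabs (a + h) <= 1 -> Re (a^*%C * h) <= 0.
Proof.
move=> a1 ah; have := sqr_cabsD a h; rewrite a1 expr1n.
have : cabs (a + h) ^+ 2 <= 1 by rewrite expr_le1 ?cabs_ge0.
by have := sqr_ge0 (cabs h); lra.
Qed.

(** A superlinear term loses against a linear gain: it suffices that d^kappa <= c / (C + 1), where
    the added 1 allows C = 0. *)
Lemma small_powR (R : realType) (C c kappa e eps : R) :
  0 <= C -> 0 < c -> 0 < kappa -> 0 < e -> 0 < eps ->
  exists d, [/\ 0 < d, d <= e, d < eps & C * powR d (1 + kappa) < c * d].
Proof.
move=> C0 c0 kappa0 e0 eps0; have C1 : 0 < C + 1 by rewrite ltr_wpDl.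
pose b := powR (c / (C + 1)) kappa^-1.
have b0 : 0 < b by rewrite powR_gt0 // divr_gt0.
pose d := Num.min b (Num.min e (eps / 2)).
have d0 : 0 < d by rewrite !lt_min b0 e0 divr_gt0.
have [db de deps] : [/\ d <= b, d <= e & d <= eps / 2].
  by rewrite /d !ge_min !lexx ?orbT.
exists d; split=> //; first by apply: le_lt_trans deps _; lra.
rewrite powRD ?(gt_eqF d0) ?implybT // powRr1 ?(ltW d0) // mulrCA mulrC ltr_pM2r //.
apply: le_lt_trans (_ : C * (c / (C + 1)) < c).
  rewrite ler_wpM2l //; have : powR d kappa <= powR b kappa.
    by apply: ge0_ler_powR; rewrite ?nnegrE //; exact: ltW.
  by rewrite /b -powRrM mulVf ?gt_eqF // powRr1 // divr_ge0 ?ltW.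
by rewrite mulrCA gtr_pMr // ltr_pdivrMr // mul1r ltrDl.
Qed.

Section Extensibility.
Variables (R : realType) (n : nat) (z : 'I_n -> R[i]).
Let p := \prod_i ('X - (z i)%:P).
Let q (h : 'I_n -> R[i]) := \prod_i ('X - (z i + h i)%:P).
Hypotheses (n1 : (1 < n)%N) (ps : simple_zeros p) (p's : simple_zeros p^`()).

Let zeros_deriv (zeta : 'I_n -> R[i]) v :
  (v \in zeros (\prod_i ('X - (zeta i)%:P))^`()) =
  root (\prod_i ('X - (zeta i)%:P))^`() v.
Proof. by rewrite mem_zeros // -size_poly_gt0 size_deriv_num size_prod_ord ltnW. Qed.

Let zeros_deriv_neq0 (zeta : 'I_n -> R[i]) :
  zeros (\prod_i ('X - (zeta i)%:P))^`() != [::].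
Proof.
rewrite -size_eq0 size_zeros -?size_poly_gt0 size_deriv_num size_prod_ord /=.
  by rewrite -lt0n -subn1 subn_gt0.
exact: ltnW.
Qed.

Lemma prod_neq0 (zeta : 'I_n -> R[i]) : \prod_i ('X - (zeta i)%:P) != 0.
Proof. by rewrite -size_poly_gt0 size_prod_ord. Qed.

Let zP l : z l \in zeros p.
Proof. by rewrite mem_zeros ?prod_neq0 // root_prod_ord; apply/existsP; exists l. Qed.

Lemma crit_dist_gt0 l : 0 < crit_dist p (z l).
Proof.
have [w wp ->] := crit_dist_attained (z l) (zeros_deriv_neq0 z).
rewrite cabs_gt0 subr_eq0; apply: contraTneq wp => <-; rewrite zeros_deriv.
by apply: simple_zero_deriv; rewrite ?prod_neq0 // -mem_zeros ?prod_neq0.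
Qed.

(* Averaging the expansions of the |v_k - (z l + h l)|^2 over the weights kills
   the terms of first order, up to terms which are <= 0 in the unit disk. *)
Lemma crit_dist_singular l : positively_singular (Amx p z l) ->
  exists2 K, 0 <= K & near0 (fun h d => (forall i, cabs (z i + h i) <= 1) ->
    crit_dist (q h) (z l + h l) <= crit_dist p (z l) + K * d ^+ 2).
Proof.
move=> /positively_singular_weights[nu [nu0 nus nuP]].
have [K K0 KP] := crit_track n1 ps p's l.
set D := crit_dist p (z l); have D0 : 0 < D := crit_dist_gt0 l.
(* Chosen so that D^2 + K d^2 <= (D + (K / D) d^2)^2. *)
exists (K / D); first by rewrite divr_ge0 // ltW.
apply: near0W KP => h d d0 _ [KP _] hz.
set X := crit_dist (q h) _; set ws := near_crit p (z l) in nu nu0 nus nuP.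
have X0 : 0 <= X by apply: crit_dist_ge0; exact: zeros_deriv_neq0.
pose rho k := Re (\sum_i alpha_coef p z l ws`_k i * h i).
have Xk (k : 'I_(size ws)) : X ^+ 2 <= D ^+ 2 * (1 + 2 * rho k) + K * d ^+ 2.
  have [wp wD] := mem_near_crit (mem_nth 0 (ltn_ord k)).
  have [v [qv _]] := KP _ wp; rewrite wD => vE.
  have Xv : X <= cabs (v - (z l + h l)).
    by rewrite cabsB; apply: crit_dist_le; rewrite zeros_deriv.
  have : X ^+ 2 <= cabs (v - (z l + h l)) ^+ 2 by rewrite lerXn2r ?nnegrE ?cabs_ge0.
  move: vE; rewrite ler_norml => /andP[_]; rewrite -/D -/(rho k); lra.
have X2 : X ^+ 2 <= D ^+ 2 + K * d ^+ 2.
  rewrite -(ler_pM2l nus) mulr_suml.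
  apply: le_trans (_ : \sum_k nu k * (D ^+ 2 * (1 + 2 * rho k) + K * d ^+ 2) <= _).
    by apply: ler_sum => k _; apply: ler_wpM2l (Xk k); exact: nu0.
  have -> : \sum_k nu k * (D ^+ 2 * (1 + 2 * rho k) + K * d ^+ 2) =
      (\sum_k nu k) * (D ^+ 2 + K * d ^+ 2) + 2 * D ^+ 2 * \sum_k nu k * rho k.
    by rewrite mulr_suml mulr_sumr -big_split; apply: eq_bigr => k _ /=; ring.
  rewrite gerDl mulr_ge0_le0 //; first by rewrite mulr_ge0 ?sqr_ge0.
  by apply: nuP => i zi; exact: Re_conj_le0.
have y0 : 0 <= K / D * d ^+ 2 by rewrite mulr_ge0 ?sqr_ge0 // divr_ge0 // ltW.
rewrite -ler_sqr ?nnegrE //; last by rewrite addr_ge0 // ltW.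
apply: le_trans X2 _.
have -> : K * d ^+ 2 = D * (K / D * d ^+ 2) by field; rewrite gt_eqF.
have := mulr_ge0 (ltW D0) y0; move: (K / D * d ^+ 2) y0 => y y0; nra.
Qed.

(** Continuity suffices here: the nearest critical point moves by at most K d and z_l by at most
    d. *)
Lemma crit_dist_lt l B : crit_dist p (z l) < B ->
  near0 (fun h d => crit_dist (q h) (z l + h l) <= B).
Proof.
have [w wp ->] := crit_dist_attained (z l) (zeros_deriv_neq0 z) => wB.
have [K K0 KP] := crit_track n1 ps p's l.
have K1 : 0 <= K + 1 by lra.
have B0 : 0 < B - cabs (z l - w) by rewrite subr_gt0.
apply: near0W (near0I KP (near0_ltM n K1 B0)) => h d d0 hd [[{}KP _] dB].
have [v [qv wv _]] := KP _ wp.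
have vq : v \in zeros (q h)^`() by rewrite zeros_deriv.
apply: le_trans (crit_dist_le _ vq) _.
have -> : z l + h l - v = (z l - w) + (h l + (w - v)) by ring.
have := cabsD (z l - w) (h l + (w - v)); have := cabsD (h l) (w - v).
by have := hd l; lra.
Qed.

Lemma linearly_inextensible_of_singular :
  (forall l, positively_singular (Amx p z l) \/ crit_dist p (z l) < dmax p) ->
  linearly_inextensible n p.
Proof.
move=> lP.
have [||K K0 [e e0 eP]] := @near0_uniform R n _ (enum 'I_n) (fun l K h d =>
  (forall i, cabs (z i + h i) <= 1) ->
  crit_dist (q h) (z l + h l) <= dmax p + K * d ^+ 2).
- move=> l K K' h d d0 KK' KP /KP /le_trans; apply.
  by rewrite lerD2l ler_wpM2r ?sqr_ge0.
- move=> l _; case: (lP l) => [/crit_dist_singular[K K0 KP]|/crit_dist_lt ltP].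
    exists K => //; apply: near0W KP => h d _ _ KP /KP /le_trans; apply.
    by rewrite lerD2r le_dmax.
  exists 0 => //; apply: near0W ltP => h d _ _ le_d _.
  by rewrite mul0r addr0.
(* The estimate is applied with d equal to [Delta n r p], and kappa = 1 turns the power into d^2. *)
exists e, K, 1; split=> // r rS rp.
have [zeta [rE D0 zD]] := Delta_displacement z rS.
set D := Delta n r p in rp D0 zD *.
have -> : powR D (1 + 1) = D ^+ 2 by rewrite -powR_mulrn.
apply: dmax_le => [|x]; first by rewrite addr_ge0 ?mulr_ge0 ?sqr_ge0 // bigmax_ge_id.
have hE i : z i + (zeta i - z i) = zeta i by rewrite addrC subrK.
have rq : r = q (fun i => zeta i - z i).
  by rewrite rE; apply: eq_bigr => i _; rewrite hE.
have rz i : root r (zeta i) by rewrite rE root_prod_ord; apply/existsP; exists i.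
rewrite rE mem_zeros ?prod_neq0 // root_prod_ord => /existsP[l /eqP ->].
rewrite -rE rq -(hE l); apply: eP => //; first exact: ltW.
  by rewrite mem_enum.
by move=> i; rewrite hE; case: rS => _ _; apply.
Qed.

(* The rows of A(p; z_l) are the rates at which h moves the nearest critical
   points away from z l and the zeros of modulus 1 into the unit disk. *)
Lemma crit_dist_increase l (c : R) : 0 < c ->
  exists2 c', 0 < c' & near0 (fun h d =>
    (forall k : 'I_(size (near_crit p (z l)) + #|unit_idx z|),
       c * d <= Re (\sum_j Amx p z l k j * h j)) ->
    (forall i, cabs (z i) = 1 -> cabs (z i + h i) <= 1) /\
    crit_dist p (z l) + c' * d <= crit_dist (q h) (z l + h l)).
Proof.
move=> c0; have [K K0 KP] := crit_track n1 ps p's l.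
set D := crit_dist p (z l); have D0 : 0 < D := crit_dist_gt0 l.
(* The squared distance grows by at least 2 c D^2 d - K d^2 >= c D^2 d, which exceeds the growth of
   (D + c' d)^2 when c d < 1. *)
pose c' := c * D / 4; have c'0 : 0 < c' by rewrite divr_gt0 // mulr_gt0.
exists c' => //.
(* Critical points farther than D lose at most (K + 1) d and so remain beyond D + c' d. *)
have far : near0 (fun (_ : 'I_n -> R[i]) d =>
    forall w, w \in [seq w <- zeros p^`() | cabs (w - z l) != D] ->
    (K + 1 + c') * d < cabs (w - z l) - D).
  apply: near0_all => w; rewrite mem_filter => /andP[wD wp].
  apply: near0_ltM; first by lra.
  by rewrite subr_gt0 lt_neqAle eq_sym wD cabsB crit_dist_le.
have cD : 0 < c * D ^+ 2 by rewrite mulr_gt0 ?exprn_gt0.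
have c2 : 0 < 2 * c by lra.
apply: near0W (near0I (near0I KP far) (near0I (near0I (near0_ltM n ler01 c2)
  (near0_ltM n (ltW c0) ltr01)) (near0_ltM n K0 cD))).
move=> h d d0 hd [[[_ {}KP] {}far] [[dc cd] Kd]] rows; split=> [i zi|].
  (* The circle row yields |z_i + h_i|^2 <= 1 - 2 c d + d^2, which is at most 1 because d < 2 c. *)
  have iu : i \in unit_idx z by rewrite inE; apply/eqP.
  have := rows (rshift _ (enum_rank_in iu i)).
  rewrite (bigD1 i) //= big1 ?addr0 => [|j ji]; last first.
    by rewrite /Amx col_mxEd mxE enum_rankK_in // (negPf ji) mul0r.
  rewrite /Amx col_mxEd mxE enum_rankK_in // eqxx mulNr => cdi.
  rewrite -(@expr_le1 _ 2) ?cabs_ge0 // sqr_cabsD zi expr1n.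
  have : cabs (h i) ^+ 2 <= d * d.
    by rewrite -[d * d]expr2 lerXn2r ?nnegrE ?cabs_ge0 // hd.
  have : Re (- ((z i)^*%C * h i)) = - Re ((z i)^*%C * h i) by case: (_ * _).
  move: cdi => /[swap] -> cdi hd2.
  have : d * d <= 2 * c * d by rewrite ler_wpM2r //; move: dc; rewrite mul1r => /ltW.
  by lra.
have [v vq ->] :=
  crit_dist_attained (z l + h l) (zeros_deriv_neq0 (fun i => z i + h i)).
move: vq; rewrite zeros_deriv => /KP[w wp [_ wv vE]]; rewrite cabsB.
have [wD|wD] := eqVneq (cabs (w - z l)) D; last first.
  have := far w; rewrite mem_filter wD wp => /(_ isT) lt.
  have := cabsD (w - v) (v - (z l + h l)); have := cabsD (w - (z l + h l)) (h l).
  rewrite addrA subrK opprD addrA subrK.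
  by have := hd l; rewrite !mulrDl mul1r in lt; lra.
have wn : w \in near_crit p (z l) by rewrite mem_filter wD eqxx.
have wi : (index w (near_crit p (z l)) < size (near_crit p (z l)))%N by rewrite index_mem.
have := rows (lshift _ (Ordinal wi)).
rewrite (eq_bigr (fun j => alpha_coef p z l w j * h j)) => [cw|j _]; last first.
  by rewrite /Amx col_mxEu mxE /= nth_index.
have cd0 : 0 <= c * d by rewrite mulr_ge0 // ltW.
have v2 : D ^+ 2 + c * D ^+ 2 * d <= cabs (v - (z l + h l)) ^+ 2.
  move: vE; rewrite wD ler_norml => /andP[vE _].
  have : K * d ^+ 2 <= c * D ^+ 2 * d by rewrite expr2 mulrA ler_wpM2r // ltW.
  have : D ^+ 2 * (c * d) <= D ^+ 2 * Re (\sum_i alpha_coef p z l w i * h i).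
    by rewrite ler_wpM2l ?sqr_ge0.
  by lra.
have c'd0 : 0 <= c' * d by apply: mulr_ge0 => //; exact: ltW.
rewrite -ler_sqr ?nnegrE ?cabs_ge0 //; last by rewrite addr_ge0 // ltW.
apply: le_trans v2.
have -> : (D + c' * d) ^+ 2 = D ^+ 2 + D ^+ 2 * (c * d) * (1 / 2 + c * d / 16).
  by rewrite /c'; field.
rewrite lerD2l [leRHS](_ : _ = D ^+ 2 * (c * d) * 1); last by ring.
by rewrite ler_wpM2l ?mulr_ge0 ?sqr_ge0 //; lra.
Qed.

(** Otherwise a step of length d in the direction given by Gordan's alternative stays in S_n and
    raises the maximum by c' d, more than C d^(1 + kappa). *)
Lemma singular_of_linearly_inextensible l :
  crit_dist p (z l) = dmax p -> (forall i, cabs (z i) <= 1) ->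
  linearly_inextensible n p -> positively_singular (Amx p z l).
Proof.
move=> lmax z1 [eps [C [kappa [eps0 C0 kappa0 LI]]]].
have [//|[g gP]] := positively_singularPn (Amx p z l); exfalso.
(* Normalizes the direction, so that (d / G) g has coordinates of modulus at most d. *)
pose G := 1 + \sum_i cabs (g i).
have G0 : 0 < G by rewrite ltr_wpDr ?sumr_ge0 // => i _; exact: cabs_ge0.
have gG i : cabs (g i) <= G.
  rewrite /G (bigD1 i) //= addrCA lerDl addr_ge0 // sumr_ge0 // => j _.
  exact: cabs_ge0.
pose rate k := Re (\sum_j Amx p z l k j * g j) / G.
have rate0 k : 0 < rate k by rewrite divr_gt0.
have [c c0 cP] : exists2 c, 0 < c & forall k, c <= rate k.
  exists (\big[Num.min/1]_k rate k) => [|k]; last exact: bigmin_le.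
  by apply: lt_bigmin.
have [c' c'0 inc] := crit_dist_increase l c0.
have inside : near0 (fun h _ => forall i, i \in enum 'I_n ->
    cabs (z i) != 1 -> cabs (z i + h i) <= 1).
  apply: near0_all => i _; have [zi|zi] := eqVneq (cabs (z i)) 1; first by exists 1.
  have z0 : 0 < 1 - cabs (z i) by rewrite subr_gt0 lt_neqAle zi z1.
  apply: near0W (near0_ltM n ler01 z0) => h d _ hd dz _.
  by have := cabsD (z i) (h i); have := hd i; lra.
have [e e0 eP] := near0I inc inside.
have [d [d0 de deps dC]] :
    exists d, [/\ 0 < d, d <= e, d < eps & C * powR d (1 + kappa) < c' * d].
  exact: small_powR.
pose h i := (d / G)%:C%C * g i.
have dG0 : 0 < d / G by exact: divr_gt0.
have hd i : cabs (h i) <= d.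
  rewrite cabsM cabs_real gtr0_norm // -mulrA ler_piMr ?(ltW d0) //.
  by rewrite mulrC ler_pdivrMr // mul1r.
have [{}inc {}inside] := eP h d (ltW d0) de hd.
have [|on_circle up] := inc.
  move=> k; have -> : \sum_j Amx p z l k j * h j =
      (d / G)%:C%C * \sum_j Amx p z l k j * g j.
    by rewrite mulr_sumr; apply: eq_bigr => j _; rewrite /h mulrCA.
  rewrite Re_realM mulrAC -mulrA mulrC ler_pM2l //; exact: cP.
have qS : in_S n (q h).
  split=> [||x]; [exact: monic_prod_XsubC|exact: size_prod_ord|].
  rewrite root_prod_ord => /existsP[i /eqP ->].
  have [/on_circle //|zi] := eqVneq (cabs (z i)) 1.
  by apply: inside; rewrite ?mem_enum.
have Dd : Delta n (q h) p <= d.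
  by apply: Delta_le => [|i]; [exact: ltW|rewrite addrC addKr].
(* Supplies [Delta] >= 0 for the monotonicity of [powR]. *)
have [zeta [_ D0 _]] := Delta_displacement z qS.
have /= qmax : crit_dist (q h) (z l + h l) <= dmax (q h).
  apply: le_dmax; rewrite mem_zeros ?prod_neq0 // root_prod_ord.
  by apply/existsP; exists l.
have := LI _ qS (le_lt_trans Dd deps).
have : C * powR (Delta n (q h) p) (1 + kappa) <= C * powR d (1 + kappa).
  rewrite ler_wpM2l // ge0_ler_powR ?nnegrE // ?(ltW d0) //.
  by rewrite addr_ge0 // ltW.
by rewrite -lmax; lra.
Qed.

End Extensibility.

(* The index i : 'I_n stands for i + 1 in the 1-based labelling. *)
Theorem theorem5 (R : realType) (n : nat) (hn : (3 <= n)%N)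
    (p : {poly R[i]}) (z : 'I_n -> R[i])
    (hpz : p = \prod_(i < n) ('X - (z i)%:P))
    (hpS : in_S n p)
    (hp : simple_zeros p) (hp' : simple_zeros p^`())
    (t : nat) (ht : (1 <= t <= n)%N)
    (hmax : forall i : 'I_n, (i < t)%N -> crit_dist p (z i) = dmax p)
    (hlt : forall i : 'I_n, (t <= i)%N -> crit_dist p (z i) < dmax p) :
  linearly_inextensible n p <->
  (forall i : 'I_n, (i < t)%N -> positively_singular (Amx p z i)).
Proof.
have n1 : (1 < n)%N by exact: ltnW.
subst p; split=> [LI l lt|sing].
  apply: singular_of_linearly_inextensible => // [|i]; first exact: hmax.
  by case: hpS => _ _; apply; rewrite root_prod_ord; apply/existsP; exists i.
apply: linearly_inextensible_of_singular => // l.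
by have [/sing|/hlt] := ltnP l t; [left|right].
Qed.
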